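(* For all $k_1,k_2\geq 1$ and $r\geq 1$ there exist colored graphs $G$ and $H$ such that Spoiler has a winning strategy for $\operatorname{BP}_{(k_1,k_2)}(G,H)$, and in every winning strategy Spoiler must (re)use every reusable pebble pair at least $r$ times (at least once if $k_1=1$) before using a new non-reusable pebble pair.
   Context: Let $[x_{k_1}]=\{x_1,\dots,x_{k_1}\}$ (reusable pebble pairs), $[y_{k_2}]=\{y_1,\dots,y_{k_2}\}$ (non-reusable pebble pairs). A $(k_1,k_2)$-configuration on colored graphs $G,H$ is a pair of partial functions $\alpha\colon[x_{k_1}]\cup[y_{k_2}]\rightharpoonup V(G)$, $\beta\colon[x_{k_1}]\cup[y_{k_2}]\rightharpoonup V(H)$ with equal domains; it induces a partial isomorphism if $\alpha(z)\mapsto\beta(z)$ is a well-defined color-preserving isomorphism $G[\operatorname{im}\alpha]\to H[\operatorname{im}\beta]$. The bijective $(k_1,k_2)$-pebble game $\operatorname{BP}_{(k_1,k_2)}(G,H)$ between Spoiler (S) and Duplicator (D) starts from the empty configuration. A round with configuration $(\alpha,\beta)$: (1) S picks a pebble pair $z$ with $z\in[x_{k_1}]$ or $\alpha(z)$ undefined (if none exists, the winning condition is checked directly); (2) D chooses a bijection $f\colon V(G)\to V(H)$ (S wins if none exists); (3) S chooses $w\in V(G)$; (4) the configuration becomes $(\alpha[z/w],\beta[z/f(w)])$, i.e. pair $z$ is placed on $w$ and $f(w)$. S wins after a round if the configuration does not induce a partial isomorphism; D wins if S never wins. *)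

(* Defs.v *)
From mathcomp Require Import all_boot.

Set Implicit Arguments.
Unset Strict Implicit.
Unset Printing Implicit Defensive.

Record cgraph := CGraph {
  vertex :> finType;
  edge : rel vertex;
  color : vertex -> nat;
  edge_sym : symmetric edge;
  edge_irr : irreflexive edge }.

Record bijection (V W : Type) := Bijection {
  bij_fun :> V -> W;
  bij_funP : bijective bij_fun }.

(* inl x : reusable pair, inr y : non-reusable pair *)
Definition pebble (k1 k2 : nat) := ('I_k1 + 'I_k2)%type.

Definition reusable k1 k2 (z : pebble k1 k2) : bool :=
  if z is inl _ then true else false.

Section Game.
Variables (k1 k2 : nat) (G H : cgraph).

(* A pair of partial functions with equal domains, presented as one partial   *)
(* function to pairs: c z = Some (v, u) stands for alpha(z) = v, beta(z) = u. *)
Definition config := pebble k1 k2 -> option (G * H).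

Definition empty_config : config := fun _ => None.

Definition partial_isomorphism (c : config) : Prop :=
  forall z z' v u v' u', c z = Some (v, u) -> c z' = Some (v', u') ->
    [/\ v = v' <-> u = u', edge v v' = edge u u' & color v = color u].

Definition available (c : config) (z : pebble k1 k2) : bool :=
  reusable z || ~~ isSome (c z).

Record round := Round {
  rd_pebble : pebble k1 k2;
  rd_bij : bijection G H;
  rd_vertex : G }.

Definition history := seq round.

Definition update (c : config) (rd : round) : config :=
  [eta c with rd_pebble rd |-> Some (rd_vertex rd, rd_bij rd (rd_vertex rd))].

Definition config_of (h : history) : config := foldl update empty_config h.

Definition spoiler_won (h : history) : Prop :=
  ~ partial_isomorphism (config_of h).

(* Spoiler names the pair before seeing the bijection, the vertex after. *)
Record strategy := Strategy {
  pick : history -> pebble k1 k2;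
  place : history -> bijection G H -> G }.

Definition next_round (s : strategy) (h : history) (f : bijection G H) :=
  Round (pick s h) f (place s h f).

(* Spoiler, following s from h, wins after finitely many rounds whatever      *)
(* Duplicator does. When there is no bijection from V(G) to V(H) the second   *)
(* premise of wins_next is vacuous, so that Spoiler wins, as the rules ask.   *)
Inductive wins_from (s : strategy) (h : history) : Prop :=
| wins_now of spoiler_won h
| wins_next of available (config_of h) (pick s h)
    & (forall f, wins_from s (rcons h (next_round s h f))).

Definition winning (s : strategy) : Prop := wins_from s [::].

Definition play (s : strategy) (fs : seq (bijection G H)) : history :=
  foldl (fun h f => rcons h (next_round s h f)) [::] fs.

(* The play stops at Spoiler's first winning round. *)
Definition complete_play (s : strategy) (fs : seq (bijection G H)) : Prop :=
  spoiler_won (play s fs) /\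
  forall i, i < size fs -> ~ spoiler_won (play s (take i fs)).

End Game.

(* Number of uses of z in p after the last use of a non-reusable pair in p    *)
(* (in all of p when there is none).                                          *)
Definition recent_uses k1 k2 (z : pebble k1 k2) (p : seq (pebble k1 k2)) : nat :=
  count_mem z (take (find (fun z' => ~~ reusable z') (rev p)) (rev p)).

(* s lists the pairs used in a play, in order. All the non-reusable pairs are *)
(* used, and each time one is used, every reusable pair has been used at      *)
(* least t times since the previous non-reusable one (or since the start).    *)
Definition reuses_before_new k1 k2 (t : nat) (s : seq (pebble k1 k2)) : Prop :=
  (forall y : 'I_k2, inr y \in s) /\
  (forall (p q : seq (pebble k1 k2)) (y : 'I_k2), s = p ++ inr y :: q ->
     forall x : 'I_k1, t <= recent_uses (inl x) p).

(* Main.v *)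
(* G and H are the untwisted and twisted Cai-Fuerer-Immerman graphs over a     *)
(* base graph, so that the pebble game becomes the game of cops and robber on *)
(* the base graph, with k1 reusable and k2 non-reusable cops; the robber is   *)
(* the place where Duplicator hides the twist.                                *)
(*   The base graph is a tree of large arity in which a node is also joined   *)
(* to its nearest ancestors: the nearest k1 - 1 in general, and the nearest   *)
(* k1 at the end and at the beginning of each of k2 blocks of levels. Spoiler *)
(* chases the robber down the tree, k1 - 1 reusable cops guarding its subtree *)
(* while the remaining one is placed below; only at the end of a block does   *)
(* he need a non-reusable cop. Conversely the robber climbs back to the top   *)
(* of its block as soon as the guard is incomplete, so that it is driven to   *)
(* the end of the block only by moving the reusable cops in turn, many times. *)
(* If Spoiler uses a non-reusable cop earlier, the robber flees to a cop-free *)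
(* branch and stays around the k1 + 1 mutually adjacent nodes at the end of   *)
(* the block; there only non-reusable cops can drive it further, one per      *)
(* block, and Spoiler is now one short.                                       *)

Require Import Defs.
From mathcomp Require Import all_boot zify.
From Stdlib Require Import Classical ClassicalEpsilon.

Set Implicit Arguments.
Unset Strict Implicit.
Unset Printing Implicit Defensive.

(** Shifting gadgets moves the twist from [root] to any node reachable along cop-free edges, and
    while it sits on a cop-free node the configuration is a partial isomorphism ([robber_at_step],
    [robber_at_iso]). [robber_move] turns each evasion of the robber into a bijection, which leaves
    a pursuit on the base tree.

    Spoiler wins by pebbling a branch level by level ([sweep]): by [odd_child] some child subtree
    always has odd parity, and the tree has bounded depth.

    For the lower bound Duplicator stays in one of three states. In [normal] the number of recent
    uses of each reusable pair bounds the level of the robber in its block. In [safe] the robber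
    survives every move ([safe_step]). In the last state all non-reusable pairs are used, each after
    enough reuses. A premature non-reusable pair leads from [normal] to [safe] ([normal_step_new]).
    A winning strategy ends the play, and this can only happen in the last state
    ([play_of_invariant]). *)

Section CFI.

(** * Cai-Fuerer-Immerman graphs *)

Variables (V : finType) (adj : rel V) (root : V).
Hypotheses (adj_sym : symmetric adj) (adj_irr : irreflexive adj).

Definition parity (n : V) (a : {ffun V -> bool}) : bool :=
  \big[addb/false]_(m | adj n m) a m.

Definition shift (a b : {ffun V -> bool}) : {ffun V -> bool} :=
  [ffun m => a m (+) b m].

Definition cfi_edge : rel (V * {ffun V -> bool}) :=
  fun p q => adj p.1 q.1 && (p.2 q.1 == q.2 p.1).

Lemma cfi_edge_sym : symmetric cfi_edge.
Proof. by move=> p q; rewrite /cfi_edge adj_sym eq_sym. Qed.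

Lemma cfi_edge_irr : irreflexive cfi_edge.
Proof. by move=> p; rewrite /cfi_edge adj_irr. Qed.

(** Each gadget contains all vectors, and the color carries the parity. Hence both graphs have the
    same vertices and edges, and the twist only recolors the gadget of [root]. *)
Definition cfi (twist : bool) : cgraph :=
  @CGraph (V * {ffun V -> bool})%type cfi_edge
    (fun p => pickle (p.1, parity p.1 p.2 (+) (twist && (p.1 == root))))
    cfi_edge_sym cfi_edge_irr.

Lemma parity_shift n a b : parity n (shift a b) = parity n a (+) parity n b.
Proof.
by rewrite /parity -big_split; apply: eq_bigr => m _; rewrite ffunE.
Qed.

Lemma shiftK b : cancel (shift^~ b) (shift^~ b).
Proof. by move=> a; apply/ffunP=> m; rewrite !ffunE -addbA addbb addbF. Qed.

Lemma shift_inj b : injective (shift^~ b).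
Proof. exact: can_inj (shiftK b). Qed.

(** * The robber and the twist *)

Section Robber.
Variables k1 k2 : nat.
Local Notation peb := (pebble k1 k2).
Local Notation config := (config k1 k2 (cfi false) (cfi true)).
Local Notation round := (round k1 k2 (cfi false) (cfi true)).
Implicit Type c : config.

Definition copmap := peb -> option V.
Definition cops c : copmap := fun z => omap (fun p => p.1.1) (c z).
Definition lift_cop (P : copmap) (z : peb) : copmap := [eta P with z |-> None].
Definition land_cop (P : copmap) (z : peb) (v : V) : copmap :=
  [eta P with z |-> Some v].
Definition free (P : copmap) (n : V) : Prop := forall z, P z <> Some n.

(* The twist of [cfi true] is moved from [root] to [rho]: [beta] is an        *)
(* isomorphism up to the parity of the gadget at [rho].                       *)
Definition robber_at c (rho : V) : Prop :=
  exists beta : V -> {ffun V -> bool},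
    [/\ forall n m, beta n m = beta m n,
        forall n, parity n (beta n) = (n == root) (+) (n == rho)
      & forall z p q, c z = Some (p, q) ->
          p.1 != rho /\ q = (p.1, shift p.2 (beta p.1))].

Inductive escape (P : copmap) (n : V) : V -> Prop :=
| escape_refl : escape P n n
| escape_step m m' : escape P n m -> adj m m' -> free P m' -> escape P n m'.

Lemma escape_trans P n m m' : escape P n m -> escape P m m' -> escape P n m'.
Proof. by move=> nm; elim=> // {}m' m'' _ IH adjm fr; apply: escape_step IH _ _. Qed.

Lemma escape1 P n m : adj n m -> free P m -> escape P n m.
Proof. exact: escape_step (escape_refl _ _). Qed.

Lemma escape_free P n m : free P n -> escape P n m -> free P m.
Proof. by move=> fr; elim. Qed.

Lemma robber_at_free c rho : robber_at c rho -> free (cops c) rho.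
Proof.
move=> [beta [_ _ H]] z; rewrite /cops.
by case E: (c z) => [[p q]|] //= [e]; have [/eqP] := H _ _ _ E.
Qed.

(** Symmetry of [beta] preserves edges. Its parity corrects the twist at every gadget but that of
    [rho], which carries no pebble. *)
Lemma robber_at_iso c rho : robber_at c rho -> partial_isomorphism c.
Proof.
move=> [beta [bsym bpar H]] z z' [n a] u [n' a'] u' E E'.
have [/= nr ->] := H _ _ _ E; have [/= nr' ->] := H _ _ _ E'; split=> /=.
- split=> [[-> ->]// |[e]]; rewrite e => /shift_inj -> //.
- rewrite /cfi_edge /= !ffunE (bsym n n').
  by case: (a n') (a' n) (beta n' n) => [] [] [].
- congr (pickle (_, _)); rewrite parity_shift bpar (negbTE nr).
  by case: (parity n a) (n == root) => [] [].
Qed.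

(** Flipping [beta] on the edge between [rho] and [rho'] changes only these two gadgets, and neither
    is pebbled. *)
Lemma robber_at_step c rho rho' :
  robber_at c rho -> adj rho rho' -> free (cops c) rho' -> robber_at c rho'.
Proof.
move=> rob ar fr; have fr0 := robber_at_free rob.
have ne : rho != rho' by apply: contraTneq ar => ->; rewrite adj_irr.
case: rob => beta [bsym bpar H].
pose tg n m := ((n == rho) && (m == rho')) || ((n == rho') && (m == rho)).
exists (fun n => [ffun m => beta n m (+) tg n m]); split=> [n m|n|z [n a] q E].
- rewrite !ffunE bsym /tg; congr (_ (+) _); rewrite orbC.
  by rewrite (andbC (n == rho')) (andbC (n == rho)).
- rewrite /parity (eq_bigr (fun m => beta n m (+) tg n m)); last first.
    by move=> m _; rewrite ffunE.
  rewrite big_split /= -/(parity _ _) bpar -addbA; congr (_ (+) _).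
  have [->|nr] := eqVneq n rho.
    rewrite (negbTE ne) (bigD1 rho') //= big1 => [|m /andP[_ /negbTE nm]].
      by rewrite /tg !eqxx.
    by rewrite /tg nm (negbTE ne) andbF.
  have [->|nr'] := eqVneq n rho'.
    rewrite (bigD1 rho) /= 1?adj_sym // big1 => [|m /andP[_ /negbTE nm]].
      by rewrite /tg !eqxx orbT.
    by rewrite /tg nm (eq_sym rho') (negbTE ne) andbF.
  by rewrite big1 // => m _; rewrite /tg (negbTE nr) (negbTE nr').
- have [/= nr ->] := H _ _ _ E.
  have nr' : n != rho' by apply/eqP=> e; apply: (fr z); rewrite /cops E /= e.
  split=> //; congr (_, _); apply/ffunP=> m; rewrite !ffunE /tg.
  by rewrite (negbTE nr) (negbTE nr') addbF.
Qed.

Lemma robber_at_escape c rho rho' :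
  robber_at c rho -> escape (cops c) rho rho' -> robber_at c rho'.
Proof. by move=> rob; elim=> // m m' _ /robber_at_step; apply. Qed.

Definition shift_bij_fun (b : {ffun V -> {ffun V -> bool}})
  (p : cfi false) : cfi true := (p.1, shift p.2 (b p.1)).

Lemma shift_bijP b : bijective (shift_bij_fun b).
Proof.
exists (fun p : cfi true => (p.1, shift p.2 (b p.1)) : cfi false);
  by case=> n a; rewrite /shift_bij_fun /= shiftK.
Qed.

Definition shift_bij b : bijection (cfi false) (cfi true) :=
  Bijection (shift_bijP b).

Lemma cops_update c rd :
  cops (update c rd) =1 land_cop (cops c) (rd_pebble rd) (rd_vertex rd).1.
Proof. by move=> z; rewrite /cops /update /land_cop /=; case: eqP. Qed.

(* Only the image of the pebbled gadget matters, so Duplicator may glue the   *)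
(* answers that he prepares for the various gadgets into one bijection: the   *)
(* robber moves after hearing where the cop will land.                        *)
Lemma robber_move c rho (z : peb) (Q : V -> V -> Prop) :
    robber_at c rho ->
    (forall v, exists rho', [/\ rho' != v,
       escape (lift_cop (cops c) z) rho rho' & Q v rho']) ->
  exists f, forall w, exists rho',
    robber_at (update c (Round z f w)) rho' /\ Q w.1 rho'.
Proof.
move=> rob mv.
pose c' : config := [eta c with z |-> None].
have copsc' : cops c' =1 lift_cop (cops c) z.
  by move=> z'; rewrite /cops /c' /lift_cop /=; case: eqP.
have rob' : robber_at c' rho.
  case: rob => beta [bsym bpar H]; exists beta; split=> // z' p q.
  by rewrite /c' /=; case: eqP => // _; apply: H.
have esc n : escape (lift_cop (cops c) z) rho n -> escape (cops c') rho n.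
  elim=> [|m m' _ IH a fr]; first exact: escape_refl.
  by apply: escape_step IH a _ => z'; rewrite copsc'; apply: fr.
have : forall v, exists rb : V * (V -> {ffun V -> bool}),
  [/\ rb.1 != v, Q v rb.1, forall n m, rb.2 n m = rb.2 m n,
      forall n, parity n (rb.2 n) = (n == root) (+) (n == rb.1)
    & forall z p q, c' z = Some (p, q) ->
          p.1 != rb.1 /\ q = (p.1, shift p.2 (rb.2 p.1))].
  move=> v; have [rho' [ne /esc /(robber_at_escape rob') [beta [? ? ?]] q]] := mv v.
  by exists (rho', beta).
case/fin_all_exists => F HF.
exists (shift_bij [ffun v => (F v).2 v]) => -[v a].
have [ne q bsym bpar H] := HF v.
exists (F v).1; split=> //; exists (F v).2; split=> // z' p u.
rewrite /update /=; case: (eqVneq z' z) => [_ [<- <-]|nz E].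
  by rewrite /= eq_sym ne /shift_bij_fun ffunE.
by apply: (H z'); rewrite /c' /= (negbTE nz).
Qed.

End Robber.
End CFI.

(** * Strategies from invariants *)

Section Strategies.
Variables (k1 k2 : nat) (G H : cgraph).
Implicit Types (s : strategy k1 k2 G H) (h : history k1 k2 G H).

Lemma config_of_rcons h rd : config_of (rcons h rd) = update (config_of h) rd.
Proof. exact: foldl_rcons. Qed.

(** The pair depends only on the number of the round. [epsilon] selects a good vertex for each
    bijection, and [N] bounds the length of the play. *)
Lemma winning_of_invariant (v0 : G) (N : nat) (pk : nat -> pebble k1 k2)
    (Inv : nat -> config k1 k2 G H -> Prop) :
    Inv 0 (@empty_config k1 k2 G H) ->
    (forall i c, Inv i c -> [/\ i < N, available c (pk i) &
       forall f, exists v, let c' := update c (Round (pk i) f v) in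
         partial_isomorphism c' -> Inv i.+1 c']) ->
  exists s, winning s.
Proof.
move=> inv0 invS.
pose good h f v := let c' := update (config_of h) (Round (pk (size h)) f v) in
  partial_isomorphism c' -> Inv (size h).+1 c'.
pose s := Strategy (fun h => pk (size h)) (fun h f => epsilon (inhabits v0) (good h f)).
exists s; rewrite /winning.
suff win d h : N - size h = d -> Inv (size h) (config_of h) -> wins_from s h.
  exact: (win _ [::] erefl inv0).
elim/ltn_ind: d h => d IH h Ed inv.
have [lt av ex] := invS _ _ inv.
apply: wins_next => // f; have := epsilon_spec (inhabits v0) _ (ex f).
rewrite -/(good h f) => gd.
case: (classic (partial_isomorphism (config_of (rcons h (next_round s h f))))).
  move=> iso; apply: (IH (N - (size h).+1)); rewrite ?size_rcons //; first lia.
  by move: iso; rewrite config_of_rcons; apply: gd.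
exact: wins_now.
Qed.
Lemma play_rcons s fs f :
  play s (rcons fs f) = rcons (play s fs) (next_round s (play s fs) f).
Proof. exact: foldl_rcons. Qed.

Definition used h := [seq rd_pebble rd | rd <- h].

Lemma used_rcons h rd : used (rcons h rd) = rcons (used h) (rd_pebble rd).
Proof. exact: map_rcons. Qed.

Lemma config_of_used h z : isSome (config_of h z) = (z \in used h).
Proof.
elim/last_ind: h => [|h rd IH] //.
rewrite config_of_rcons used_rcons mem_rcons inE /update /=.
by case: eqVneq.
Qed.

Definition reuses_before (t : nat) (p : seq (pebble k1 k2)) : Prop :=
  forall p1 p2 y, p = p1 ++ inr y :: p2 ->
    forall x, t <= recent_uses (inl x) p1.

Lemma reuses_before_rcons t p z : reuses_before t p ->
    (forall y, z = inr y -> forall x, t <= recent_uses (inl x) p) ->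
  reuses_before t (rcons p z).
Proof.
move=> rp last p1 p2 y; case/lastP: p2 => [|p2 z'].
  by rewrite cats1 => /rcons_inj[<- /last].
by rewrite -rcons_cons -rcons_cat => /rcons_inj[ep _]; apply: rp ep.
Qed.

Lemma recent_uses_rcons (z z' : pebble k1 k2) p : recent_uses z (rcons p z') =
  if reusable z' then (z' == z) + recent_uses z p else 0.
Proof.
by rewrite /recent_uses rev_rcons /=; case: z' => x /=.
Qed.

(** Duplicator follows a branch of the well-founded proof of [winning s] that preserves [J]; the
    branch ends in a won history. *)
Lemma play_of_invariant s (J R : history k1 k2 G H -> Prop) :
    winning s -> J [::] ->
    (forall h, J h -> spoiler_won h -> R h) ->
    (forall h, J h -> available (config_of h) (Defs.pick s h) ->
       exists f, J (rcons h (next_round s h f))) ->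
  exists fs, complete_play s fs /\ R (play s fs).
Proof.
move=> win J0 JR JS.
suff ext h : wins_from s h -> forall fs, h = play s fs -> J h ->
    (forall i, i < size fs -> ~ spoiler_won (play s (take i fs))) ->
    exists fs', complete_play s fs' /\ R (play s fs').
  exact: (ext _ win [::]).
elim=> {win}h => [won|av _ IH] fs eh Jh nw.
  by exists fs; rewrite /complete_play -eh; split=> //; apply: JR.
(* [wins_next] may also apply to a history already won, where a complete play has to stop. *)
have [won|nwon] := classic (spoiler_won h).
  by exists fs; rewrite /complete_play -eh; split=> //; apply: JR.
have [f Jf] := JS _ Jh av.
apply: (IH f (rcons fs f)) => //; first by rewrite play_rcons -eh.
move=> i; rewrite size_rcons ltnS leq_eqVlt => /predU1P[->|lt].
  by rewrite -cats1 take_size_cat // -eh.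
by rewrite -cats1 takel_cat; [apply: nw|exact: ltnW].
Qed.
End Strategies.

(** * The base graph *)

Section Base.
Variables w l t : nat.
Local Notation k1 := w.+1.
Local Notation k2 := l.+1.
Hypothesis t_gt0 : 0 < t.
Hypothesis t_w0 : w = 0 -> t = 1.

(* Chosen so that level [block_len - w] of a block is level [k1 * t + k1]:    *)
(* driving the robber there costs [t] uses of each reusable pair.             *)
Definition block_len := k1 * t + k1 + w.
Local Notation L := block_len.
Definition arity := (k1 + k2).+1.
Local Notation T := 'I_arity.
Definition node := (k2 * L).-bseq T.
Local Notation peb := (pebble k1 k2).
Local Notation copmap := (copmap node k1 k2).
Implicit Types (P : copmap) (a u v n rho : node).

(* Stated at [T], since [lia] does not identify [size] at [T] with [size] at  *)
(* [Equality.sort T].                                                         *)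
Lemma size_prefix_ord (u v : seq T) : prefix u v -> size u <= size v.
Proof. exact: size_prefix. Qed.

Lemma prefix_comparable (u v a : seq T) :
  prefix u a -> prefix v a -> size u <= size v -> prefix u v.
Proof.
by rewrite !prefixE => /eqP eu /eqP ev le; rewrite -{1}ev take_takel // eu.
Qed.

Lemma prefix_size_eq (u v : seq T) :
  prefix u v -> size v <= size u -> u = v.
Proof. by rewrite prefixE => /eqP uv le; rewrite -uv take_oversize. Qed.

(* [k1] cops can sweep the levels of reach [w], but the two levels around the *)
(* end of a block (sizes count from 0, depths from 1) need one cop more.      *)
Definition reach (i : nat) := if i.+1 %% L <= 1 then k1 else w.

Definition above (u v : seq T) :=
  [&& prefix u v, size u < size v & size v - size u <= reach (size v)].

Definition nadj : rel node := fun u v => above u v || above v u.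

Lemma nadj_sym : symmetric nadj.
Proof. by move=> u v; rewrite /nadj orbC. Qed.

Lemma nadj_irr : irreflexive nadj.
Proof. by move=> u; rewrite /nadj /above ltnn andbF. Qed.

Lemma block_len_ge : k1 < L.
Proof. by clear t_w0; rewrite /L; nia. Qed.

Lemma reach_ge i : w <= reach i.
Proof. by rewrite /reach; case: ifP. Qed.

(** For [w = 0] only levels at the border of two blocks have an edge upwards. With [t = 1] blocks
    have two levels, so every level is at a border; this is where [k1 = 1] limits the number of
    reuses. *)
Lemma reach_gt0 i : 0 < reach i.
Proof.
rewrite /reach; case: ifP => // /negbT; case: (posnP w) => // w0.
have -> : L = 2 by rewrite /L w0 t_w0.
by rewrite -ltnNge; have := ltn_pmod i.+1 (isT : 0 < 2); lia.
Qed.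

Lemma reach_block i b : i.+1 = b * L -> reach i = k1.
Proof. by rewrite /reach => ->; rewrite modnMl. Qed.

Lemma reach_next_block b : reach (b * L) = k1.
Proof. by rewrite /reach -addn1 modnMDl leq_mod. Qed.

(** * Cop-free branches and guarded ancestors *)

Definition clean P (r : seq T) := forall z m, P z = Some m -> ~~ prefix r m.

Lemma clean_free P (r : seq T) n : clean P r -> prefix r n -> free P n.
Proof. by move=> cl pr z /cl; rewrite pr. Qed.

Lemma clean_prefix P (r r' : seq T) : clean P r -> prefix r r' -> clean P r'.
Proof.
by move=> cl rr z m /cl; apply: contra; apply: prefix_trans.
Qed.

Lemma clean_land P z v (r : seq T) : clean (land_cop P z v) r ->
  clean (lift_cop P z) r /\ ~~ prefix r v.
Proof.
move=> cl; split=> [z' m|]; last by apply: (cl z); rewrite /land_cop /= eqxx.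
rewrite /lift_cop /=; case: eqP => // /eqP ne E.
by apply: (cl z'); rewrite /land_cop /= (negbTE ne).
Qed.

(** The arity exceeds the number of cops: were no branch clean, every letter would occur at position
    [size s] of some pebbled node. *)
Lemma clean_child P (s : seq T) : exists i : T, clean P (rcons s i).
Proof.
case: (pickP [pred i |
  [forall z, if P z is Some m then ~~ prefix (rcons s i) m else true]]).
  by move=> i /forallP cl; exists i => z m E; have := cl z; rewrite E.
move=> none; pose C := pmap P (enum {: 'I_k1 + 'I_k2}).
have : {subset enum T <= [seq nth ord0 (val m) (size s) | m : node <- C]}.
  move=> i _; have /negbT := none i; rewrite /= negb_forall => /existsP [z].
  case E: (P z) => [m|] //; rewrite negbK => /prefixP [s' em].
  apply/mapP; exists m; first by rewrite mem_pmap -E map_f // mem_enum.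
  by rewrite [val m]em nth_cat size_rcons ltnS leqnn nth_rcons ltnn eqxx.
move/(uniq_leq_size (enum_uniq _)); rewrite -cardE card_ord size_map.
have : size C <= k1 + k2.
  rewrite size_pmap (leq_trans (count_size _ _)) // -cardE card_sum.
  by rewrite !card_ord.
by move=> leC geC; have := leq_trans geC leC; rewrite ltnn.
Qed.

Lemma child_node n (i : T) : size n < k2 * L ->
  exists2 m : node, rcons n i = m :> seq T & nadj n m.
Proof.
move=> lt; have le : size (rcons n i) <= k2 * L by rewrite size_rcons.
exists (Bseq le) => //; rewrite /nadj /above /= prefix_rcons size_rcons ltnSn /=.
by rewrite subSnn reach_gt0.
Qed.

Lemma walk_down P (r : seq T) n e : clean P r -> prefix r n ->
    size n <= e <= k2 * L ->
  exists a : node, [/\ prefix n a, size a = e & escape nadj P n a].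
Proof.
move=> cl pr /andP[]; move Ed: (e - size n) => d.
elim: d n Ed pr => [|d IH] n Ed pr le le'.
  by exists n; rewrite prefix_refl; split; [|lia|left].
have lt : size n < k2 * L by lia.
have [m em adjm] := child_node ord0 lt.
have nm : prefix n m by rewrite -em prefix_rcons.
have rm := prefix_trans pr nm.
have sm : size m = (size n).+1 by rewrite -em size_rcons.
have [||||a [ma sa ea]] := IH m; rewrite ?sm //; try lia.
exists a; split=> //; first exact: prefix_trans nm ma.
by apply: escape_trans ea; apply: escape1 adjm _; apply: clean_free cl rm.
Qed.

(** The branch also avoids the landing node [v], so the robber is out of the way when the cop
    lands. *)
Lemma descend P (z : peb) v rho e : size rho < e <= k2 * L ->
  exists (i : T) (a : node), [/\ clean (land_cop P z v) (rcons rho i),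
    prefix (rcons rho i) a, size a = e & escape nadj (lift_cop P z) rho a].
Proof.
move=> /andP[lt le].
have [i cl] := clean_child (land_cop P z v) rho.
have [cl' _] := clean_land cl.
have [|n en adjn] := child_node (n := rho) i; first lia.
have sn : size n = (size rho).+1 by rewrite -en size_rcons.
have [||a [na sa ea]] := walk_down cl' (n := n) (e := e).
- by rewrite en prefix_refl.
- by rewrite sn lt.
exists i, a; rewrite en; split=> //; last first.
  apply: escape_trans ea; apply: escape1 adjn _.
  by apply: clean_free cl' _; rewrite en prefix_refl.
by rewrite -en.
Qed.

(** Only [w] reusable pairs differ from [x]. The equality case locates all of them. *)
Lemma pigeonhole P (x : 'I_k1) (S : seq node) : uniq S ->
    (forall n, n \in S -> exists2 x', x' != x & P (inl x') = Some n) ->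
  size S <= w /\
  (size S = w -> forall x', x' != x -> exists2 n, n \in S & P (inl x') = Some n).
Proof.
move=> uS cov.
pose X := [set x' | (x' != x) && (P (inl x') \in map Some S)].
have szX : size S <= #|X|.
  have : {subset map Some S <= [seq P (inl x') | x' <- enum X]}.
    move=> _ /mapP[n nS ->]; have [x' ne E] := cov n nS.
    by rewrite -E map_f // mem_enum inE ne E map_f.
  move/(uniq_leq_size _); rewrite !size_map -cardE; apply.
  by rewrite map_inj_uniq // => ? ? [].
have XC : X \subset [set~ x] by apply/subsetP=> x'; rewrite !inE => /andP[].
have cC : #|[set~ x]| = w by rewrite cardsC1 card_ord.
have := subset_leq_card XC; rewrite cC => leX; split; first exact: leq_trans leX.
move=> eS x' ne; have : x' \in X.
  suff -> : X = [set~ x] by rewrite !inE.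
  by apply/eqP; rewrite eqEcard XC cC /= (leq_trans _ szX) ?eS.
by rewrite inE => /andP[_ /mapP[n nS E]]; exists n.
Qed.

(** The robber climbs as long as an adjacent ancestor below [s] is free; it stops only under a
    complete guard. *)
Lemma retreat P (s : node) rho : free P rho -> prefix s rho ->
  exists rho' : node, [/\ prefix s rho', prefix rho' rho, escape nadj P rho rho'
    & forall n, prefix s n -> above n rho' -> exists z, P z = Some n].
Proof.
move Ed: (size rho) => d; elim/ltn_ind: d rho Ed => d IH rho Ed fr pr.
case: (pickP [pred n : node | [&& prefix s n, above n rho & [forall z, P z != Some n]]]).
  move=> n /= /and3P[sn an /forallP frn].
  have {}frn : free P n by move=> z; apply/eqP.
  have /and3P[pn ltn _] := an.
  have [|rho' [? ? esc ?]] := IH _ _ n erefl frn sn; first by rewrite -Ed.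
  exists rho'; split=> //; first exact: prefix_trans pn.
  by apply: escape_trans esc; apply: escape1 frn; rewrite /nadj an orbT.
move=> none; exists rho; split=> //; first exact: prefix_refl; first by left.
move=> n sn an; have /negbT := none n; rewrite /= sn an /= negb_forall.
by move=> /existsP[z]; rewrite negbK => /eqP; exists z.
Qed.

(** A prefix of [a] always fits, so the default of [insubd] never shows. *)
Definition node_take a (i : nat) : node := insubd a (take i a).

Lemma val_node_take a i : node_take a i = take i a :> seq T.
Proof.
by rewrite val_insubd ifT // (leq_trans _ (size_bseq a)) // size_take_min geq_minr.
Qed.

Lemma size_node_take a i : i <= size a -> size (node_take a i) = i.
Proof. by rewrite val_node_take size_take_min => /minn_idPl. Qed.

Lemma node_take_size n a : prefix n a -> node_take a (size n) = n.
Proof.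
by move=> pn; apply: val_inj; rewrite /= val_node_take; apply/eqP; rewrite -prefixE.
Qed.

Definition chain a (m : nat) : seq node :=
  [seq node_take a (size a - j.+1) | j <- iota 0 m].

Lemma chain_uniq a m : m <= size a -> uniq (chain a m).
Proof.
move=> le; rewrite map_inj_in_uniq ?iota_uniq // => j j'; rewrite !mem_iota => lj lj'.
by move/(congr1 (fun n : node => size n)); rewrite !size_node_take; lia.
Qed.

Lemma size_chain a m : size (chain a m) = m.
Proof. by rewrite size_map size_iota. Qed.

Lemma mem_chain a m n : m <= size a ->
  (n \in chain a m) = [&& prefix n a, size n < size a & size a - size n <= m].
Proof.
move=> le; apply/mapP/and3P => [[j]|[pn ltn len]].
  rewrite mem_iota => lj ->; rewrite size_node_take ?val_node_take ?prefix_take; last lia.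
  by split=> //; lia.
exists (size a - (size n).+1); first by rewrite mem_iota; lia.
have -> : size a - (size a - (size n).+1).+1 = size n by lia.
by rewrite node_take_size.
Qed.

(** * Survival of the robber *)

Definition unused P := #|[set y : 'I_k2 | ~~ isSome (P (inr y))]|.

Lemma unused_new P y v : P (inr y) = None ->
  unused P = (unused (land_cop P (inr y) v)).+1.
Proof.
move=> Py; rewrite /unused (cardsD1 y) inE Py /= add1n; congr _.+1.
by apply: eq_card => y'; rewrite !inE /= /land_cop /=; case: (eqVneq y' y) => [->|ne];
  rewrite /= ?eqxx // /eq_op /= (negbTE ne).
Qed.

Lemma free_lift P z n : free P n -> free (lift_cop P z) n.
Proof. by move=> fr z'; rewrite /lift_cop /=; case: eqP => // _; apply: fr. Qed.

Lemma lift_or_land P z v z' n : lift_cop P z z' = Some n ->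
  land_cop P z v z' = Some n.
Proof. by rewrite /land_cop /lift_cop /=; case: eqP. Qed.

Definition bag a n := prefix n a && (size a - size n < k1).

Lemma bagE a n : w <= size a -> bag a n = (n \in a :: chain a w).
Proof.
move=> le; rewrite inE mem_chain // /bag; case: (eqVneq n a) => [->|ne] /=.
  by rewrite prefix_refl subnn.
case pn: (prefix n a) => //=; rewrite ltnS; case: (ltnP (size n)) => //= ge.
by case/eqP: ne; apply: val_inj; apply: prefix_size_eq pn ge.
Qed.

Lemma bag_refl a : bag a a.
Proof. by rewrite /bag prefix_refl subnn. Qed.

Lemma bag_free P x a : w <= size a ->
    (forall y n, P (inr y) = Some n -> ~~ bag a n) ->
  exists2 n, bag a n & free (lift_cop P (inl x)) n.
Proof.
move=> le yfree.
case: (pickP [pred n | bag a n && [forall z, lift_cop P (inl x) z != Some n]]).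
  by move=> n /andP[bn /forallP fr]; exists n => // z; apply/eqP.
move=> none; have [||] := @pigeonhole P x (a :: chain a w).
- rewrite /= chain_uniq // mem_chain //; by rewrite ltnn andbF.
- move=> n; rewrite -bagE // => bn; have /negbT := none n.
  rewrite /= bn /= negb_forall => /existsP[z]; rewrite negbK => /eqP.
  rewrite /lift_cop /=; case: eqP => //; case: z => [x'|y] ne E.
    by exists x' => //; apply: contra_not_neq ne => ->.
  by have := yfree _ _ E; rewrite bn.
by rewrite /= size_chain ltnn.
Qed.

Lemma nadj_bag a n n' : bag a n -> bag a n' -> n != n' -> nadj n n'.
Proof.
wlog le : n n' / size n <= size n'.
  move=> H bn bn' ne; case: (leqP (size n) (size n')) => [|/ltnW] le.
    exact: H.
  by rewrite nadj_sym; apply: H => //; rewrite eq_sym.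
move=> /andP[pn sn] /andP[pn' sn'] ne.
have pp := prefix_comparable pn pn' le.
have lt : size n < size n'.
  rewrite ltnNge; apply/negP=> ge; case/eqP: ne; apply: val_inj.
  exact: prefix_size_eq pp ge.
rewrite /nadj /above pp lt /=; apply/orP; left.
have := reach_ge (size n'); have := size_prefix_ord pn'; lia.
Qed.

(** Here the larger reach at the start of a block matters: [bag a] and a child of [a] form a clique
    of [k1 + 1] nodes. *)
Lemma nadj_bag_child a c n n' i : (size a).+1 = c * L -> bag a n ->
  rcons a i = n' :> seq T -> nadj n n'.
Proof.
move=> sa /andP[pn sn] en; rewrite /nadj /above -en size_rcons sa.
rewrite reach_next_block (prefix_trans pn (prefix_rcons a i)) /=; apply/orP; left.
have := size_prefix_ord pn; lia.
Qed.

(* A robber at one of the [k1] mutually adjacent nodes [bag a], or at a child *)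
(* of [a], needs only one more block of the tree for each unused pair.        *)
Definition safe P rho := exists a c, [/\ (size a).+1 = c * L,
  c + unused P <= k2,
  forall y n, P (inr y) = Some n -> ~~ bag a n &
  bag a rho \/ exists2 i, rcons a i = rho :> seq T &
                 forall n, bag a n -> exists x, P (inl x) = Some n].

Lemma block_end_size a c : (size a).+1 = c * L -> k1 <= size a.
Proof.
move=> sa; have := block_len_ge; case: c sa => [|c]; rewrite ?mulSn; lia.
Qed.

Lemma block_le c c' : c <= c' -> c * L <= c' * L.
Proof. by rewrite leq_mul2r orbC => ->. Qed.

Lemma safe_descend P y v rho b : P (inr y) = None ->
    size rho + k1 < b.+1 * L -> b + unused P <= k2 ->
  exists rho', [/\ rho' != v, escape nadj (lift_cop P (inr y)) rho rho' &
    safe (land_cop P (inr y) v) rho'].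
Proof.
move=> Py srho le; have Lg := block_len_ge; have un := unused_new v Py.
have bL : b.+1 * L <= k2 * L by apply: block_le; lia.
have [|i [a [cl pa sa esc]]] := @descend P (inr y) v rho (b.+1 * L).-1.
  lia.
have [_ nv] := clean_land cl.
have sub n : bag a n -> prefix (rcons rho i) n.
  move=> /andP[pn sn]; apply: prefix_comparable pa pn _.
  rewrite size_rcons; lia.
exists a; split=> //; first by apply: contraNneq nv => <-.
exists a, b.+1; split; last by left; apply: bag_refl.
- rewrite sa; lia.
- lia.
by move=> y' n E; apply: contra (cl _ _ E); apply: sub.
Qed.

Lemma safe_step P rho z v : safe P rho -> free P rho ->
    reusable z \/ P z = None ->
  exists rho', [/\ rho' != v, escape nadj (lift_cop P z) rho rho' &
    safe (land_cop P z v) rho'].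
Proof.
move=> [a [c [sa le yfree rob]]] fr av.
have Lg := block_len_ge; have lesa := block_end_size sa.
have lecL : c * L <= k2 * L by apply: block_le; lia.
case: z av => [x _|y [] // Py]; last first.
  have un := unused_new v Py.
  have lecL' : c.+1 * L <= k2 * L by apply: block_le; lia.
  have [r0 er esc] : exists2 r0 : node, size r0 = c * L &
      escape nadj (lift_cop P (inr y)) rho r0.
    case: rob => [brho|[i er _]]; last first.
      by exists rho; [rewrite -er size_rcons|left].
    have [i cl] := clean_child P a.
    have [|r0 er _] := child_node (n := a) i; first lia.
    exists r0; first by rewrite -er size_rcons.
    apply: escape1; first exact: nadj_bag_child sa brho er.
    by apply: free_lift; apply: clean_free cl _; rewrite er prefix_refl.
  have [||r' [ne esc' sf]] := @safe_descend P y v r0 c Py; rewrite ?er ?mulSn; try lia.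
  by exists r'; split=> //; apply: escape_trans esc'.
have [n bn frn] := @bag_free P x a (ltnW lesa) yfree.
have to_bag m : bag a m -> free (lift_cop P (inl x)) m ->
  escape nadj (lift_cop P (inl x)) rho m.
  move=> bm frm; have [->|ne] := eqVneq m rho; first by left.
  apply: escape1 => //; case: rob => [brho|[i er _]].
    by rewrite nadj_sym; apply: nadj_bag bm brho ne.
  by rewrite nadj_sym; apply: nadj_bag_child sa bm er.
have yfree' y m : land_cop P (inl x) v (inr y) = Some m -> ~~ bag a m.
  exact: yfree.
case: (pickP [pred m | [&& bag a m, m != v &
  [forall z, lift_cop P (inl x) z != Some m]]]).
  move=> m /and3P[bm ne /forallP frm]; exists m; split=> //.
    by apply: to_bag => // z; apply/eqP.
  by exists a, c; split=> //; left.
(* The cop lands on the last free node of the bag; reusable cops then fill the bag and the robber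
   hides at a child of [a]. *)
move=> none.
have full m : bag a m -> exists x', land_cop P (inl x) v (inl x') = Some m.
  move=> bm; have [->|ne] := eqVneq m v.
    by exists x; rewrite /land_cop /= eqxx.
  have /negbT := none m; rewrite /= bm ne /= negb_forall => /existsP[z].
  rewrite negbK => /eqP E; case: z E => [x'|y] E.
    by exists x'; apply: lift_or_land.
  by have := yfree _ _ E; rewrite bm.
have bv : bag a v.
  suff -> : v = n by [].
  have /negbT := none n; rewrite /= bn /=; case: eqVneq => //= _.
  by rewrite negb_forall => /existsP[z]; rewrite negbK => /eqP /frn.
suff [i [r0 [er ne esc]]] : exists i (r0 : node), [/\ rcons a i = r0 :> seq T, r0 != v
   & escape nadj (lift_cop P (inl x)) rho r0].
  exists r0; split=> //; exists a, c; split=> //.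
  by right; exists i.
have notv i (r0 : node) : rcons a i = r0 :> seq T -> r0 != v.
  move=> er; apply: contraTneq bv => <-; rewrite /bag -er.
  by apply/negP => /andP[/size_prefix]; rewrite size_rcons ltnn.
case: rob => [brho|[i er _]]; last first.
  by exists i, rho; split; [|apply: notv er|left].
have [i cl] := clean_child (lift_cop P (inl x)) a.
have [|r0 er _] := child_node (n := a) i; first lia.
exists i, r0; split=> //; first exact: notv er.
apply: escape1; first exact: nadj_bag_child sa brho er.
by apply: clean_free cl _; rewrite er prefix_refl.
Qed.

(* Sweeping a block: to push the robber one level down Spoiler must move the  *)
(* pair that stands [k1] levels above, so the number of uses of each          *)
(* reusable pair grows with the level of the robber in its block.             *)
Definition normal P (U : 'I_k1 -> nat) rho := exists (s : node) b,
  [/\ size s = b * L, b + unused P = k2, prefix s rho /\ size rho < size s + L,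
      forall y n, P (inr y) = Some n -> ~~ prefix s n &
      (forall x, (size rho - size s - w) %/ k1 <= U x) /\
      (forall x n, P (inl x) = Some n -> prefix s n -> prefix n rho ->
         (size n - size s).+1 %/ k1 <= U x)].

(** The robber retreats under a complete guard and goes one level down only if the cop lands on it;
    the guarding pairs have then been used often enough for the new level. *)
Lemma normal_step_reusable P U rho x v :
    normal P U rho -> free P rho -> 0 < unused P ->
  exists rho', [/\ rho' != v, escape nadj (lift_cop P (inl x)) rho rho' &
    normal (land_cop P (inl x) v) (fun x' => (x' == x) + U x') rho'].
Proof.
move=> [s [b [ss bk [srho ltrho] yfree [Urho Ucop]]]] fr un0.
have Lg := block_len_ge; have lebL : b.+1 * L <= k2 * L by apply: block_le; lia.
have [rho' [srho' prho' esc conf]] := retreat (free_lift (z := inl x) fr) srho.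
have lerho' := size_prefix_ord prho'; have geros := size_prefix_ord srho'.
have frho' := escape_free (free_lift (z := inl x) fr) esc.
have divS m : m.+1 %/ k1 <= ((m - w) %/ k1).+1.
  case: (leqP w m) => [le|lt]; last by rewrite divn_small //; lia.
  by rewrite -{1}(subnK le) -addnS divnDr ?dvdnn // divnn addn1.
have Ux : ((size rho' - size s).+1) %/ k1 <= (U x).+1.
  apply: leq_trans (divS _) _; rewrite ltnS; apply: leq_trans (Urho x).
  by apply: leq_div2r; lia.
have yfree' y n : land_cop P (inl x) v (inr y) = Some n -> ~~ prefix s n.
  exact: yfree.
have chainP m n : m <= size rho' - size s -> m <= reach (size rho') ->
    n \in chain rho' m ->
    exists2 x', x' != x & P (inl x') = Some n /\ prefix s n /\ prefix n rho'.
  move=> lem ler; rewrite mem_chain; last lia.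
  move=> /and3P[pn ltn len].
  have sn : prefix s n by apply: prefix_comparable srho' pn _; lia.
  have [|z] := conf n sn; first by rewrite /above pn ltn; lia.
  rewrite /lift_cop /=; case: eqP => //; case: z => [x'|y] ne E.
    by exists x' => //; apply: contra_not_neq ne => ->.
  by have := yfree _ _ E; rewrite sn.
have Ucop' n x' : prefix n rho' -> prefix s n ->
    land_cop P (inl x) v (inl x') = Some n ->
    (size n - size s).+1 %/ k1 <= (x' == x) + U x'.
  move=> pn sn; have [->|ne] := eqVneq x' x.
    rewrite /land_cop /= eqxx => -[_]; apply: leq_trans Ux; apply: leq_div2r.
    by have := size_prefix_ord pn; lia.
  rewrite /land_cop /= ifN; last by apply: contraNneq ne => -[->].
  by move=> E; apply: Ucop E sn (prefix_trans pn prho').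
have [ev|nev] := eqVneq rho' v; last first.
  exists rho'; split=> //; exists s, b; split=> //.
    by split=> //; lia.
  split=> [x'|x' n E sn pn]; last exact: Ucop'.
  by apply: leq_trans (leq_div2r _ _) (leq_trans (Urho x') (leq_addl _ _)); lia.
(* At the end of a block the guard consists of [k1] nodes, but only [w] cops are left to hold it. *)
have lt' : (size rho').+1 < size s + L.
  rewrite ltnNge; apply/negP=> ge; have se : (size rho').+1 = b.+1 * L.
    by have := mulSn b L; lia.
  have := reach_block se => rk.
  have [||] := @pigeonhole P x (chain rho' k1).
  - by apply: chain_uniq; lia.
  - by move=> n /chainP[||x' ne []]; [lia|lia|exists x'].
  by rewrite size_chain ltnn.
have [i cl] := clean_child (lift_cop P (inl x)) rho'.
have [|m em adjm] := child_node (n := rho') i; first lia.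
have sm : size m = (size rho').+1 by rewrite -em size_rcons.
have pm : prefix rho' m by rewrite -em prefix_rcons.
exists m; split.
- by rewrite -ev; apply/eqP=> e; move: sm; rewrite e; lia.
- apply: escape_trans esc _; apply: escape1 adjm _.
  by apply: clean_free cl _; rewrite em prefix_refl.
exists s, b; split=> //.
  by split; [exact: prefix_trans pm|lia].
split=> [x'|x' n E sn pn]; last first.
  case: (leqP (size n) (size rho')) => [le|lt].
    by apply: Ucop' E => //; apply: prefix_comparable pn pm _.
  have en : n = m by apply: val_inj; apply: prefix_size_eq pn _; rewrite sm.
  move: E; rewrite /land_cop /=; case: eqP => [_ [e]|ne E].
    by move: sm; rewrite -en -e -ev; lia.
  suff : ~~ prefix (rcons rho' i) n by rewrite em en prefix_refl.
  by apply: (cl (inl x')); rewrite /lift_cop /=; case: eqP.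
rewrite sm; have [->|ne] := eqVneq x' x.
  by apply: leq_trans (leq_div2r _ _) Ux; lia.
(* Fewer than [w] levels below [s] the quotient is 0. Otherwise the guard needs all [w] other pairs,
   so [x'] stands at most [w] levels above [rho'], and the bound for its node suffices. *)
rewrite add0n; case: (leqP w (size rho' - size s)) => [le|lt]; last first.
  by rewrite divn_small //; lia.
have [||_ surj] := @pigeonhole P x (chain rho' w).
- by apply: chain_uniq; lia.
- move=> n /chainP[||x'' ne' []]; [lia|exact: reach_ge|by exists x''].
have [n nS E] := surj (size_chain _ _) x' ne.
have [||x'' _ [_ [sn pn]]] := chainP w n _ _ nS; [lia|exact: reach_ge|].
apply: leq_trans (Ucop _ _ E sn (prefix_trans pn prho')); apply: leq_div2r.
by move: nS; rewrite mem_chain; [move=> /and3P[]; lia|lia].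
Qed.

(** If a bag still fits below [rho] in the block, the robber becomes safe. Otherwise it is so deep
    that every reusable pair has been used [t] times, and it starts the next block. *)
Lemma normal_step_new P U rho y v :
    normal P U rho -> P (inr y) = None ->
  exists rho', [/\ rho' != v, escape nadj (lift_cop P (inr y)) rho rho' &
    safe (land_cop P (inr y) v) rho' \/
    (forall x, t <= U x) /\ normal (land_cop P (inr y) v) (fun=> 0) rho'].
Proof.
move=> [s [b [ss bk [srho ltrho] yfree [Urho Ucop]]]] Py.
have Lg := block_len_ge; have un := unused_new v Py.
have lerho := size_prefix_ord srho.
have lebL : b.+1 * L <= k2 * L by apply: block_le; lia.
have [le|lt] := leqP (size rho + k1).+1 (b.+1 * L).
  have [||rho' [ne esc sf]] := @safe_descend P y v rho b Py; try lia.
  by exists rho'; split=> //; left.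
have [|i [a [cl pa sa esc]]] := @descend P (inr y) v rho (b.+1 * L).
  by have := mulSn b L; lia.
have [_ nv] := clean_land cl; have cla := clean_prefix cl pa.
exists a; split=> //; first by apply: contraNneq nv => <-.
right; split=> [x|].
  (* Here [size rho - size s] is at least [L - k1], and [L - k1 - w] is [k1 * t]. *)
  apply: leq_trans (Urho x); rewrite -[t](mulKn _ (ltn0Sn w)); apply: leq_div2r.
  by have := mulSn b L; have : L = k1 * t + k1 + w by []; lia.
exists a, b.+1; split=> //; first lia.
- by rewrite prefix_refl; split=> //; lia.
- by move=> y' n; apply: cla.
split=> [x|x n /cla /negP na /na //].
by rewrite subnn div0n.
Qed.

(** * Spoiler's sweep *)

Definition root : node := [bseq].
Definition graphG := cfi root nadj_sym nadj_irr false.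
Definition graphH := cfi root nadj_sym nadj_irr true.
Local Notation config := (config k1 k2 graphG graphH).

(** The number of reusable rounds before round [i]; [sweep] uses the reusable pairs cyclically. *)
Fixpoint xrank (i : nat) : nat :=
  if i is j.+1 then xrank j + ~~ (L %| j.+1) else 0.

(* Round [i] is played on a node of size [i], that is, at depth [i.+1].       *)
Definition sweep (i : nat) : peb :=
  if L %| i.+1 then inr (inord (i.+1 %/ L).-1) else inl (inord (xrank i %% k1)).

Lemma xrank_bounds i j : i <= j -> xrank i <= xrank j <= xrank i + (j - i).
Proof.
elim: j => [|j IH]; first by rewrite leqn0 => /eqP->; rewrite leqnn.
rewrite leq_eqVlt => /predU1P[->|]; first by rewrite leqnn leq_addr.
by rewrite ltnS => /[dup] ij /IH /andP[? ?] /=; case: (L %| _); lia.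
Qed.

Lemma sweep_new_inj i j : i < j -> j <= k2 * L -> L %| i.+1 -> L %| j.+1 ->
  sweep i <> sweep j.
Proof.
move=> lt le di dj; rewrite /sweep di dj => -[] /(congr1 val).
have Lg := block_len_ge.
have [/dvdnP[a ea] /dvdnP[b eb]] := (di, dj).
rewrite ea eb !mulnK; try lia.
have a0 : 0 < a by case: a ea.
have ab : a < b by rewrite -(ltn_pmul2r (_ : 0 < L)) -?ea -?eb; lia.
have bk : b <= k2 by rewrite -ltnS -(ltn_pmul2r (_ : 0 < L)) -?eb ?mulSn; lia.
by rewrite /= !inordK; lia.
Qed.

(** Neighbors above level [i] are still pebbled when round [i] is played, since fewer than [k1]
    reusable rounds separate [j] from [j']. *)
Lemma sweep_live i j j' : j < j' <= i -> i <= k2 * L -> i - j <= reach i ->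
  sweep j' <> sweep j.
Proof.
move=> /andP[lt le] lei ler.
case dj: (L %| j.+1); case dj': (L %| j'.+1).
- by move=> e; apply: (sweep_new_inj lt _ dj dj'); [lia|rewrite e].
- by rewrite /sweep dj dj'.
- by rewrite /sweep dj dj'.
have inc : xrank j.+1 = (xrank j).+1 by rewrite /= dj addn1.
have /andP[ge _] := xrank_bounds lt; rewrite inc in ge.
have ub : xrank j' < xrank j + k1.
  have /andP[_ up] := xrank_bounds (ltnW lt).
  case: (leqP (j' - j) w) => [|gt]; first lia.
  (* A gap of [k1] forces [j' = i] at the start of a block; round [i - 1] was then non-reusable and
     does not count. *)
  move: ler; rewrite /reach; case: ifP => [md ler|_]; last lia.
  have ei : i = j' by lia.
  have di : L %| i.
    move: md; case E: (i.+1 %% L) => [|[|//]] _.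
      by move: dj'; rewrite -ei /dvdn E.
    by apply/dvdnP; exists (i.+1 %/ L); have := divn_eq i.+1 L; rewrite E; lia.
  case: i ler {le lei md} ei di => [|m] ler ei di; first lia.
  have lejm : j < m.
    rewrite ltn_neqAle; apply/andP; split; last lia.
    by apply/eqP=> e; move: dj; rewrite e di.
  have /andP[_ up'] := xrank_bounds (ltnW lejm).
  by rewrite -ei /= di addn0; lia.
rewrite /sweep dj dj' => -[] /(congr1 val); rewrite /= !inordK ?ltn_pmod // => /eqP.
by rewrite eqn_mod_dvd; [move=> /dvdn_leq; lia|lia].
Qed.

Definition strict_prefix u v := prefix u v && (u != v).

(* The parity, inside the subtree of [n], of the shifts [b] of the gadgets    *)
(* above [n]; when it is odd the robber is in this subtree.                   *)
Definition subtree_odd n (b : node -> {ffun node -> bool}) : bool :=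
  (n == root) (+)
  \big[addb/false]_(m : node | prefix n m)
     \big[addb/false]_(p | strict_prefix p n && nadj p m) b p m.

Lemma above_strict u v : above u v -> strict_prefix u v.
Proof.
move=> /and3P[pu lt _]; rewrite /strict_prefix pu.
by apply: contraTneq lt => ->; rewrite ltnn.
Qed.

Lemma nadj_not_below n m :
  nadj n m && ~~ strict_prefix n m = strict_prefix m n && nadj m n.
Proof.
rewrite [nadj m n]nadj_sym andbC; case nm: (nadj n m); rewrite ?andbF // !andbT.
have asym u v : strict_prefix u v -> strict_prefix v u -> False.
  move=> /andP[uv ne] /andP[vu _]; case/eqP: ne; apply: val_inj.
  by apply: prefix_size_eq uv _; apply: size_prefix_ord.
case/orP: nm => /above_strict nm; rewrite nm /=.
  by apply/esym/negP => /(asym _ _ nm).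
by apply/negP => /asym; apply.
Qed.

(** If all child subtrees were even, their sum would be even. The parity of [a] at [n] and its
    agreement with [b] on edges going up make this sum equal to the odd parity at [n]. *)
Lemma odd_child n (b : node -> {ffun node -> bool}) (a : {ffun node -> bool}) :
    subtree_odd n b -> parity nadj n a = (n == root) ->
    (forall p, strict_prefix p n -> nadj p n -> b p n = a p) ->
  exists n' : node, [/\ prefix n n', size n' = (size n).+1 &
    subtree_odd n' (fun p => if p == n then a else b p)].
Proof.
move=> odd par edg; pose b' (p : node) := if p == n then a else b p.
case: (pickP [pred n' : node |
  [&& prefix n n', size n' == (size n).+1 & subtree_odd n' b']]).
  by move=> n' /and3P[? /eqP ? ?]; exists n'.
move=> none; exfalso.
pose B (m : node) := \big[addb/false]_(p : node | prefix p n && nadj p m) b' p m.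
have child_prefix (p n' : node) : prefix n n' -> size n' = (size n).+1 ->
    strict_prefix p n' = prefix p n.
  move=> nn' sn'; apply/andP/idP => [[pn' ne]|pn]; last first.
    split; first exact: prefix_trans nn'.
    by apply: contraTneq pn => ->; apply/negP => /size_prefix_ord; lia.
  apply: (prefix_comparable pn' nn'); rewrite leqNgt; apply/negP=> lt.
  by case/eqP: ne; apply: val_inj; apply: prefix_size_eq pn' _; rewrite sn'.
have sumB : \big[addb/false]_(m : node | strict_prefix n m) B m = false.
  rewrite (partition_big (fun m => node_take m (size n).+1)
    (fun n' : node => prefix n n' && (size n' == (size n).+1))) /=.
    apply: big1 => n' /andP[nn' /eqP sn'].
    have := none n'; rewrite /= nn' sn' eqxx /= /subtree_odd.
    have -> : (n' == root) = false.
      by apply/eqP=> e; move: sn'; rewrite e.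
    rewrite addFb => odd0; rewrite -[RHS]odd0; apply: eq_big => [m|m _].
      apply/andP/idP => [[/andP[nm _] /eqP <-]|n'm].
        by rewrite val_node_take prefix_take.
      split; last by rewrite -sn' node_take_size.
      rewrite /strict_prefix (prefix_trans nn' n'm).
      by apply: contraTneq n'm => <-; apply/negP => /size_prefix_ord; lia.
    by apply: eq_bigl => p; rewrite child_prefix.
  move=> m /andP[nm ne].
  have lt : size n < size m.
    rewrite ltnNge; apply/negP=> ge; case/eqP: ne; apply: val_inj.
    exact: prefix_size_eq nm ge.
  rewrite size_node_take // eqxx andbT.
  by apply: prefix_comparable nm _ _; rewrite ?val_node_take ?prefix_take // size_takel.
have BE m : B m = (nadj n m && a m) (+)
    \big[addb/false]_(p | strict_prefix p n && nadj p m) b p m.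
  have b'E p : strict_prefix p n && nadj p m -> b' p m = b p m.
    by rewrite /b' => /andP[/andP[_ /negbTE->]].
  rewrite -(eq_bigr _ b'E) /B; case nm: (nadj n m) => /=.
    rewrite (bigD1 n) ?prefix_refl ?nm //= {1}/b' eqxx; congr (_ (+) _).
    by apply: eq_bigl => p; rewrite andbAC.
  apply: eq_bigl => p; rewrite /strict_prefix -andbA.
  by case: eqVneq => [->|]; rewrite ?nm ?andbF.
pose up := \big[addb/false]_(p | strict_prefix p n && nadj p n) a p.
pose down := \big[addb/false]_(m | nadj n m && strict_prefix n m) a m.
pose far := \big[addb/false]_(m | strict_prefix n m)
  \big[addb/false]_(p | strict_prefix p n && nadj p m) b p m.
have parE : parity nadj n a = down (+) up.
  rewrite /parity (bigID (strict_prefix n)) /=; congr (_ (+) _).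
  by apply: eq_bigl => m; rewrite nadj_not_below.
have oddE : subtree_odd n b = (n == root) (+) (up (+) far).
  rewrite /subtree_odd (bigD1 n) ?prefix_refl //=; congr (_ (+) (_ (+) _)).
    by apply: eq_bigr => p /andP[]; apply: edg.
  by apply: eq_bigl => m; rewrite /strict_prefix eq_sym.
have sumE : down (+) far = false.
  rewrite -[RHS]sumB (eq_bigr _ (fun m _ => BE m)) big_split /=; congr (_ (+) _).
  by rewrite -big_mkcondr; apply: eq_bigl => m; rewrite andbC.
by move: odd sumE; rewrite oddE -par parE; case: (up); case: (down); case: (far).
Qed.

(** Spoiler always chooses the zero vector, so that Duplicator's answer is the shift itself. Only
    pairs not moved since round [size p] are recorded. *)
Definition sweeping (i : nat) (c : config) : Prop :=
  exists (n : node) (b : node -> {ffun node -> bool}),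
  [/\ size n = i,
      forall p, strict_prefix p n ->
        (forall j, size p < j < i -> sweep j <> sweep (size p)) ->
        c (sweep (size p)) = Some ((p, [ffun=> false]), (p, b p)),
      forall z, (forall j, j < i -> sweep j <> z) -> c z = None &
      subtree_odd n b].

Lemma sweeping0 : sweeping 0 (@empty_config k1 k2 graphG graphH).
Proof.
exists root, (fun=> [ffun=> false]); split=> //.
  by move=> p /andP[]; rewrite prefixs0 => /eqP e /eqP[]; apply: val_inj.
rewrite /subtree_odd eqxx big1 // => m _; apply: big1 => p _.
by rewrite ffunE.
Qed.

Lemma sweeping_available i c : sweeping i c -> available c (sweep i).
Proof.
move=> [n [b [sn _ new _]]]; rewrite /available.
case E: (sweep i) => [x|y] //=; rewrite new // -E => j lt.
case di: (L %| i.+1) E => E; last by rewrite /sweep di in E.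
case dj: (L %| j.+1); last by rewrite /sweep dj di.
by apply: sweep_new_inj => //; rewrite -sn size_bseq.
Qed.

Lemma sweepingS i c : sweeping i c ->
  forall f, exists v : graphG, let c' := update c (Round (sweep i) f v) in
    partial_isomorphism c' -> sweeping i.+1 c'.
Proof.
move=> [n [b [sn old new odd]]] f.
pose v : graphG := (n, [ffun=> false]); exists v => /= iso.
move E: (f v) => u; case: u E => m a E.
have cn : update c (Round (sweep i) f v) (sweep i) = Some (v, (m, a)).
  by rewrite /update /= eqxx E.
(* The color forces the answer into the gadget of [n], with the parity that [odd_child] needs. *)
have [_ _ /(pcan_inj pickleK) /= [em par]] := iso _ _ _ _ _ _ cn cn.
rewrite -{m}em in E cn par.
have {}par : parity nadj n a = (n == root).
  move: par; rewrite addbF {1}/parity big1 => [|? _]; last by rewrite ffunE.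
  by case: (parity nadj n a) (n == root) => [] [].
have lei : i <= k2 * L by rewrite -sn size_bseq.
have keep z : sweep i <> z -> update c (Round (sweep i) f v) z = c z.
  by move=> ne; rewrite /update /= ifN //; apply/eqP => e; apply: ne.
have edg p : strict_prefix p n -> nadj p n -> b p n = a p.
  move=> pn /orP[] ap; last first.
    have /andP[np _] := above_strict ap; case/andP: pn => pn /eqP[]; apply: val_inj.
    by apply: prefix_size_eq pn _; apply: size_prefix_ord.
  have /and3P[_ lt ler] := ap; rewrite sn in lt ler.
  have live j : size p < j <= i -> sweep j <> sweep (size p).
    by move=> lj; apply: sweep_live lj lei ler.
  have cp : c (sweep (size p)) = Some ((p, [ffun=> false]), (p, b p)).
    by apply: old => // j lj; apply: live; lia.
  rewrite -keep in cp; last by apply: live; lia.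
  have [_ + _] := iso _ _ _ _ _ _ cp cn.
  by rewrite /= /cfi_edge /= /nadj ap /= !ffunE eqxx => /esym/eqP.
have [n' [nn' sn' odd']] := odd_child odd par edg.
exists n', (fun p => if p == n then a else b p); split=> //; first by rewrite sn' sn.
- move=> p /andP[pn' ne] live; have [->|pnn] := eqVneq p n; first by rewrite sn cn.
  have lepn : size p <= size n.
    rewrite -ltnS -sn' ltn_neqAle size_prefix_ord // andbT.
    apply/eqP=> e; case/eqP: ne; apply: val_inj; apply: prefix_size_eq pn' _.
    by rewrite e.
  have pn := prefix_comparable pn' nn' lepn.
  have ltpn : size p < i.
    rewrite -sn ltn_neqAle lepn andbT; apply/eqP=> e; case/eqP: pnn; apply: val_inj.
    by apply: prefix_size_eq pn _; rewrite e.
  rewrite keep //; last by apply: live; lia.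
  apply: old; first by rewrite /strict_prefix pn.
  by move=> j lj; apply: live; lia.
- move=> z nz; rewrite keep //; last by apply: nz.
  by apply: new => j lj; apply: nz; lia.
Qed.

Lemma spoiler_wins : exists s : strategy k1 k2 graphG graphH, winning s.
Proof.
apply: (@winning_of_invariant _ _ _ _ ((root, [ffun=> false]) : graphG)
  (k2 * L).+1 sweep sweeping sweeping0) => i c sw; split.
(* No node is longer than [k2 * L], so the invariant cannot survive round [k2 * L]. *)
- by have [n [b [<- _ _ _]]] := sw; rewrite ltnS size_bseq.
- exact: sweeping_available.
- exact: sweepingS.
Qed.

(** * Duplicator's play *)

Local Notation history := (history k1 k2 graphG graphH).
Implicit Type h : history.

Lemma normal_ext P P' U U' rho : P =1 P' -> U =1 U' ->
  normal P U rho -> normal P' U' rho.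
Proof.
move=> eP eU [s [b [ss bk sr yf [Ur Uc]]]].
have eun : unused P' = unused P by apply: eq_card => y; rewrite !inE eP.
exists s, b; split=> //; first by rewrite eun.
  by move=> y n; rewrite -eP; apply: yf.
by split=> [x|x n]; rewrite -eU // -eP; apply: Uc.
Qed.

Lemma safe_ext P P' rho : P =1 P' -> safe P rho -> safe P' rho.
Proof.
move=> eP [a [c [sa le yf rob]]].
have eun : unused P' = unused P by apply: eq_card => y; rewrite !inE eP.
exists a, c; split=> //; first by rewrite eun.
  by move=> y n; rewrite -eP; apply: yf.
case: rob => [|[i er full]]; [by left|right].
by exists i => // n /full[x]; rewrite eP; exists x.
Qed.

Definition recent h (x : 'I_k1) : nat := recent_uses (inl x) (used h).

Definition duplicator_safe h :=
  exists2 rho, robber_at (config_of h) rho & safe (cops (config_of h)) rho.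

Definition duplicator_normal h := reuses_before t (used h) /\
  exists rho, [/\ robber_at (config_of h) rho,
    0 < unused (cops (config_of h)) & normal (cops (config_of h)) (recent h) rho].

Definition duplicator_done h := reuses_before_new t (used h).

Lemma unused0_used h : unused (cops (config_of h)) = 0 ->
  forall y : 'I_k2, inr y \in used h.
Proof.
move=> /eqP; rewrite cards_eq0 => /eqP/setP un0 y.
rewrite -config_of_used; have := un0 y; rewrite !inE /cops.
by case: (config_of h (inr y)).
Qed.

Lemma available_cops h z : available (config_of h) z ->
  reusable z \/ cops (config_of h) z = None.
Proof.
by rewrite /available /cops => /orP[->|]; [left|case: (config_of h z) => //; right].
Qed.

Lemma robber_round h z (Q : copmap -> node -> Prop) rho :
    robber_at (config_of h) rho ->
    (forall P P' n, P =1 P' -> Q P n -> Q P' n) ->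
    (forall v, exists rho', [/\ rho' != v,
       escape nadj (lift_cop (cops (config_of h)) z) rho rho' &
       Q (land_cop (cops (config_of h)) z v) rho']) ->
  exists f, forall v : graphG, let h' := rcons h (Round z f v) in
    exists rho', robber_at (config_of h') rho' /\ Q (cops (config_of h')) rho'.
Proof.
move=> rob Qext mv.
have [f Hf] := @robber_move _ _ root nadj_sym nadj_irr _ _ (config_of h) rho z
  (fun v n => Q (land_cop (cops (config_of h)) z v) n) rob mv.
exists f => v h'; have [rho' [rob' q]] := Hf v; exists rho'.
rewrite config_of_rcons; split=> //; apply: Qext q => z'.
by rewrite cops_update.
Qed.

Lemma duplicator_step (s : strategy k1 k2 graphG graphH) h :
    [\/ duplicator_safe h, duplicator_normal h | duplicator_done h] ->
    available (config_of h) (Defs.pick s h) ->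
  exists f, let h' := rcons h (next_round s h f) in
    [\/ duplicator_safe h', duplicator_normal h' | duplicator_done h'].
Proof.
move=> J av; have avc := available_cops av.
case: J => [[rho rob sf]|[rb [rho [rob un nm]]]|[all rb]].
- have [f Hf] := robber_round rob (Q := safe) (@safe_ext)
    (fun v => safe_step v sf (robber_at_free rob) avc).
  exists f => h'; apply: Or31; have [rho' [rob' sf']] := Hf (place s h f).
  by exists rho'.
- move: avc {av}; case Ez: (Defs.pick s h) => [x|y] avc.
    have [||f Hf] := robber_round (z := inl x) rob
      (Q := fun P n => normal P (fun x' => (x' == x) + recent h x') n /\ 0 < unused P).
    + move=> P P' n eP [nm' un']; split; first exact: normal_ext eP _ nm'.
      by rewrite (_ : unused P' = unused P) //; apply: eq_card => y; rewrite !inE eP.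
    + move=> v; have [rho' [ne esc nm']] :=
        normal_step_reusable x v nm (robber_at_free rob) un.
      by exists rho'; split.
    exists f => h'; apply: Or32; have [rho' [rob' [nm' un']]] := Hf (place s h f).
    rewrite /h' /next_round Ez; split.
      by rewrite used_rcons /=; apply: reuses_before_rcons.
    exists rho'; split=> //; apply: normal_ext nm' => // x'.
    rewrite /recent used_rcons recent_uses_rcons /= eq_sym; congr (nat_of_bool _ + _).
  case: avc => // Py.
  have [||f Hf] := robber_round (z := inr y) rob
    (Q := fun P n => safe P n \/ (forall x, t <= recent h x) /\ normal P (fun=> 0) n).
  + move=> P P' n eP [sf|[le nm']]; first by left; apply: safe_ext sf.
    by right; split=> //; apply: normal_ext nm'.
  + by move=> v; apply: normal_step_new nm Py.
  exists f => h'; have [rho' [rob' q]] := Hf (place s h f).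
  rewrite /h' /next_round Ez; case: q => [sf|[le nm']].
    by apply: Or31; exists rho'.
  have rb' : reuses_before t (used (rcons h (Round (inr y) f (place s h f)))).
    by rewrite used_rcons; apply: reuses_before_rcons => // ? _.
  have [un0|un1] :=
      posnP (unused (cops (config_of (rcons h (Round (inr y) f (place s h f)))))).
    by apply: Or33; split=> //; apply: unused0_used.
  apply: Or32; split=> //; exists rho'; split=> //; apply: normal_ext nm' => // x'.
  by rewrite /recent used_rcons recent_uses_rcons.
(* No non-reusable pair is left to be picked, so any bijection would do. *)
- exists (shift_bij root nadj_sym nadj_irr [ffun=> [ffun=> false]]) => h'.
  apply: Or33; rewrite /duplicator_done /h' used_rcons /=; split.
    by move=> y; rewrite mem_rcons inE all orbT.
  apply: reuses_before_rcons => // y Ez; move: av.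
  by rewrite /available Ez config_of_used all.
Qed.

Lemma duplicator_reuses (s : strategy k1 k2 graphG graphH) : winning s ->
  exists fs, complete_play s fs /\ reuses_before_new t (used (play s fs)).
Proof.
move=> win; pose J h := [\/ duplicator_safe h, duplicator_normal h | duplicator_done h].
have un0 : unused (cops (config_of ([::] : history))) = k2.
  by rewrite /unused -[RHS]card_ord -cardsT; apply: eq_card => y; rewrite !inE.
apply: (@play_of_invariant _ _ _ _ s J duplicator_done win).
- apply: Or32; split; first by move=> [].
  exists root; split.
  + exists (fun=> [ffun=> false]); split=> // [n m|n]; first by rewrite !ffunE.
    by rewrite addbb /parity big1 // => m _; rewrite ffunE.
  + by rewrite un0.
  exists root, 0; split=> //.
  + by split=> //=; have := block_len_ge; lia.
(* In the first two states the robber certifies a partial isomorphism, so a won history is in the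
   third. *)
- by move=> h [[rho rob _]|[_ [rho [rob _ _]]]|//] [];
    apply: robber_at_iso rob.
- by move=> h Jh av; apply: duplicator_step.
Qed.

End Base.

Theorem theorem18 (k1 k2 r : nat) (hk1 : 1 <= k1) (hk2 : 1 <= k2)
    (hr : 1 <= r) :
  exists G H : cgraph,
    (exists s : strategy k1 k2 G H, winning s) /\
    (forall s : strategy k1 k2 G H, winning s ->
       exists fs : seq (bijection G H),
         complete_play s fs /\
         reuses_before_new (if k1 == 1 then 1 else r)
           [seq rd_pebble rd | rd <- play s fs]).
Proof.
case: k1 hk1 => // w _; case: k2 hk2 => // l _.
set t := if _ then _ else _.
have t_gt0 : 0 < t by rewrite /t; case: ifP.
have t_w0 : w = 0 -> t = 1 by rewrite /t => ->.
exists (graphG w l t), (graphH w l t); split; first exact: spoiler_wins.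
by move=> s /(duplicator_reuses t_gt0 t_w0).
Qed.
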